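(* Any iterated function system of similarities on $\mathbb{R}$ satisfying the finite neighbour condition has the weak separation condition.
   Context: An iterated function system (IFS) $\mathcal{S}=\{S_i\}_{i=1}^k$ is a finite set of similarities $S_i(x)=r_ix+d_i:\mathbb{R}\to\mathbb{R}$ with $0<|r_i|<1$ and $k\ge 2$. Its self-similar set $K$ is the unique non-empty compact set with $K=\bigcup_{j=1}^k S_j(K)$. Standing assumption: $K$ is not a singleton and (after rescaling and translating) the convex hull of $K$ is $[0,1]$. Words: $\Sigma=\{1,\dots,k\}$ and $\Sigma^*$ is the set of all finite words on $\Sigma$ (the empty word corresponds to the identity map, with ratio $1$). For $\sigma=(\sigma_1,\dots,\sigma_j)$ put $S_\sigma=S_{\sigma_1}\circ\cdots\circ S_{\sigma_j}$, $r_\sigma=\prod_{i=1}^j r_{\sigma_i}$ and (for $j\ge1$) $\sigma^-=(\sigma_1,\dots,\sigma_{j-1})$. For $\alpha>0$ let $\Lambda_\alpha=\{\sigma\in\Sigma^*: |r_\sigma|<\alpha\le |r_{\sigma^-}|\}$. Weak separation condition: there is some $x_0\in\mathbb{R}$ and an integer $N$ (or, equivalently, for all $x_0$ there is some $N$) such that for any $\alpha>0$ and any finite word $\tau$, any closed ball of radius $\alpha$ contains no more than $N$ distinct points of the form $S_\sigma(S_\tau(x_0))$ with $\sigma\in\Lambda_\alpha$. Net intervals and neighbour sets: for $\alpha>0$ let $h_1<\dots<h_{s(\alpha)}$ be the distinct elements of $\{S_\sigma(0),S_\sigma(1):\sigma\in\Lambda_\alpha\}$ and $\mathcal{F}_\alpha=\{[h_j,h_{j+1}]:1\le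 j<s(\alpha),\ (h_j,h_{j+1})\cap K\ne\emptyset\}$ (net intervals of generation $\alpha$). For $\Delta\in\mathcal{F}_\alpha$, $T_\Delta(x)=rx+a$ is the unique such map with $r>0$ and $T_\Delta([0,1])=\Delta$. The neighbour set of $\Delta\in\mathcal{F}_\alpha$ is the set of maps $V_\alpha(\Delta)=\{T_\Delta^{-1}\circ S_\sigma:\sigma\in\Lambda_\alpha,\ S_\sigma([0,1])\supseteq\Delta\}$. Finite neighbour condition: the collection of all neighbour sets $\{V_\alpha(\Delta):\alpha>0,\ \Delta\in\mathcal{F}_\alpha\}$ is finite. *)

(* Defs.v *)
From HB Require Import structures.
From mathcomp Require Import all_boot all_order all_algebra.
From mathcomp Require Import all_classical all_reals all_analysis.

Set Implicit Arguments.
Unset Strict Implicit.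
Unset Printing Implicit Defensive.

Import Order.TTheory GRing.Theory Num.Theory.
Import numFieldNormedType.Exports.

Local Open Scope classical_set_scope.
Local Open Scope ring_scope.

(* The maps are an indexed family; they are not required to be distinct. *)
Record IFS (R : realType) := mkIFS {
  nmaps : nat;
  nmaps_ge2 : (2 <= nmaps)%N;
  ratio : 'I_nmaps -> R;
  trans : 'I_nmaps -> R;
  ratio_gt0 : forall i, 0 < `|ratio i|;
  ratio_lt1 : forall i, `|ratio i| < 1
}.

Definition word (R : realType) (S : IFS R) : Type := seq 'I_(nmaps S).

Definition sim (R : realType) (S : IFS R) (i : 'I_(nmaps S)) (x : R) : R :=
  ratio i * x + trans i.

Definition wsim (R : realType) (S : IFS R) (s : word S) : R -> R :=
  foldr (fun i f => @sim R S i \o f) id s.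

Definition wratio (R : realType) (S : IFS R) (s : word S) : R :=
  \prod_(i <- s) ratio i.

Definition self_similar_set (R : realType) (S : IFS R) (K : set R) : Prop :=
  [/\ K !=set0, compact K & K = \bigcup_(i in [set: 'I_(nmaps S)]) (sim i @` K)].

Definition convex_hull (R : realType) (A : set R) : set R :=
  smallest (@convex_set R R^o) A.

(* On the empty word this returns the empty word. *)
Definition parent (R : realType) (S : IFS R) (s : word S) : word S :=
  take (size s).-1 s.

(* The empty word is never a member: it would require 1 < a <= 1. *)
Definition Lambda (R : realType) (S : IFS R) (a : R) : set (word S) :=
  [set s | `|wratio s| < a /\ a <= `|wratio (parent s)|].
Arguments Lambda {R} S a _.

Definition weak_separation (R : realType) (S : IFS R) : Prop :=
  exists (x0 : R) (N : nat), forall (a : R) (t : word S) (c : R), 0 < a ->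
    (closed_ball c a `&` [set wsim s (wsim t x0) | s in Lambda S a] #<= `I_N)%card.

Definition endpoints (R : realType) (S : IFS R) (a : R) : set R :=
  [set wsim s 0 | s in Lambda S a] `|` [set wsim s 1 | s in Lambda S a].

(* A closed interval [h, h'] is represented by the pair (h, h'). *)
Definition net_interval (R : realType) (S : IFS R) (K : set R) (a : R) :
    set (R * R) :=
  [set D | [/\ endpoints S a D.1, endpoints S a D.2, D.1 < D.2,
               forall h, endpoints S a h -> ~ (D.1 < h < D.2)
             & (`]D.1, D.2[%classic `&` K) !=set0 ]].

Definition netT (R : realType) (D : R * R) (x : R) : R :=
  (D.2 - D.1) * x + D.1.

Definition netTinv (R : realType) (D : R * R) (x : R) : R :=
  (x - D.1) / (D.2 - D.1).

Lemma netTK (R : realType) (D : R * R) :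
  D.1 < D.2 -> cancel (netT D) (netTinv D).
Proof.
move=> lt x; rewrite /netT /netTinv addrK mulrC mulKf //.
by rewrite subr_eq0 gt_eqF.
Qed.

Lemma netTinvK (R : realType) (D : R * R) :
  D.1 < D.2 -> cancel (netTinv D) (netT D).
Proof.
move=> lt x; rewrite /netT /netTinv mulrC divfK ?subrK //.
by rewrite subr_eq0 gt_eqF.
Qed.

Lemma netT_image (R : realType) (D : R * R) :
  D.1 < D.2 -> netT D @` `[0, 1]%classic = `[D.1, D.2]%classic.
Proof.
move=> lt; have d0 : 0 < D.2 - D.1 by rewrite subr_gt0.
apply/seteqP; split => [_ [x] /= /[!in_itv] /= /andP[x0 x1] <-|y /=].
  rewrite /netT lerDr mulr_ge0 ?(ltW d0) //= -lerBrDr.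
  by rewrite ger_pMr.
rewrite in_itv /= => /andP[y0 y1]; exists (netTinv D y); last exact: netTinvK.
rewrite /= in_itv /= /netTinv divr_ge0 ?subr_ge0 ?(ltW lt) //=.
by rewrite ler_pdivrMr // mul1r lerD2r.
Qed.

Definition neighbour_set (R : realType) (S : IFS R) (a : R) (D : R * R) :
    set (R -> R) :=
  [set netTinv D \o wsim s | s in
     [set s | Lambda S a s /\ `[D.1, D.2]%classic `<=` wsim s @` `[0, 1]%classic]].

Definition finite_neighbour_condition (R : realType) (S : IFS R) (K : set R) :
    Prop :=
  finite_set [set V : set (R -> R) | exists (a : R) (D : R * R),
    [/\ 0 < a, net_interval S K a D & V = neighbour_set S a D]].

(* Main.v *)
(* Let G be the union of all neighbour sets; it is a finite set of maps, since
   each Lambda_a is finite.  For s in Lambda_a the set S_s(K) is infinite while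
   generation a has finitely many endpoints, so S_s([0,1]) contains a net
   interval D, and S_s = T_D \o g with g in G.  The maps of G have bounded
   ratio, hence |D| >= delta * a with delta independent of a and s.  Distinct
   net intervals of a generation do not overlap, so boundedly many such D meet
   a ball of radius 2a; a point S_s(y) is determined by D and g. *)
Require Import Defs.
From mathcomp Require Import all_boot all_order all_algebra.
From mathcomp Require Import all_classical all_reals all_analysis.
From mathcomp Require Import ring lra.

Set Implicit Arguments.
Unset Strict Implicit.
Unset Printing Implicit Defensive.

Import Order.TTheory GRing.Theory Num.Theory.
Import numFieldNormedType.Exports.

Local Open Scope classical_set_scope.
Local Open Scope ring_scope.

(** * Extrema of finite sets of reals *)

Section FiniteSets.
Context {R : realType}.
Implicit Types A : set R.

Lemma finite_set_max A : finite_set A -> A !=set0 ->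
  exists2 m, A m & forall h, A h -> h <= m.
Proof.
move=> /finite_seqP[s ->]; case: s => [|x s] [y //= _].
elim: s x {y} => [|y s IH] x; first by exists x => [|h]; rewrite /= inE // => /eqP ->.
have [m ms mmax] := IH y.
exists (Num.max x m) => [|h]; last first.
  by rewrite in_cons le_max => /predU1P[->|/mmax ->]; rewrite ?lexx ?orbT.
by rewrite in_cons /Num.max; case: ifP; rewrite ?eqxx ?ms ?orbT.
Qed.

Lemma finite_set_min A : finite_set A -> A !=set0 ->
  exists2 m, A m & forall h, A h -> m <= h.
Proof.
move=> finA [x Ax].
have [||_ [m Am <-] mmax] := @finite_set_max (-%R @` A).
- exact: finite_image.
- by exists (- x), x.
by exists m => // h Ah; rewrite -lerN2; apply: mmax; exists h.
Qed.

End FiniteSets.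

(** * Word maps, generations and net intervals of an IFS *)

Section IteratedFunctionSystem.
Context {R : realType} (S : IFS R).
Implicit Types (s t : word S) (a : R) (K : set R).

Lemma wsimE s x : wsim s x = wratio s * x + wsim s 0.
Proof.
elim: s => [|i s IH]; first by rewrite /wratio big_nil mul1r addr0.
by rewrite /= /sim [in LHS]IH /wratio big_cons; ring.
Qed.

Lemma wratio_neq0 s : wratio s != 0.
Proof.
rewrite /wratio; elim: s => [|i s IH]; first by rewrite big_nil oner_eq0.
by rewrite big_cons mulf_neq0 // -normr_gt0 ratio_gt0.
Qed.

Lemma wsim_inj s : injective (wsim s).
Proof.
by move=> x y; rewrite wsimE [RHS]wsimE => /addIr /(mulfI (wratio_neq0 s)).
Qed.

Lemma ratio_bounds : exists rho m : R,
  [/\ 0 < m, rho < 1 & forall i : 'I_(nmaps S), m <= `|Defs.ratio i| <= rho].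
Proof.
exists (\big[Num.max/0]_(i < nmaps S) `|Defs.ratio i|),
       (\big[Num.min/1]_(i < nmaps S) `|Defs.ratio i|).
split=> [||i]; last by rewrite bigmin_le le_bigmax.
- by apply: lt_bigmin => // i _; exact: ratio_gt0.
- by apply: bigmax_lt => // i _; exact: ratio_lt1.
Qed.

Lemma wratio_rcons s i : wratio (rcons s i) = wratio s * Defs.ratio i.
Proof. by rewrite /wratio big_rcons /= mulrC. Qed.

Lemma parent_rcons s i : parent (rcons s i) = s.
Proof. by rewrite /parent size_rcons /= -cats1 take_size_cat. Qed.

Lemma Lambda_rcons a s : Lambda S a s -> exists t i,
  [/\ s = rcons t i, `|wratio s| < a & a <= `|wratio t|].
Proof.
case/lastP: s => [[/lt_le_trans/[apply]]|t i]; first by rewrite ltxx.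
by rewrite /Lambda /= parent_rcons => -[]; exists t, i.
Qed.

(** The parent has ratio at least [a], and the last letter shrinks it by no more than the smallest
    ratio [m]. Since [m] depends on [S] alone, this later gives a scale-free lower bound on lengths
    of net intervals. *)
Lemma Lambda_ratio_ge : exists2 m : R, 0 < m &
  forall a s, 0 < a -> Lambda S a s -> m * a <= `|wratio s|.
Proof.
have [rho [m [m0 _ mle]]] := ratio_bounds; exists m => // a s a0.
move=> /Lambda_rcons[t [i [-> _ at_]]].
rewrite wratio_rcons normrM mulrC.
apply: ler_pM => //; [exact: ltW|exact: ltW|by case/andP: (mle i)].
Qed.

(** * Finiteness of each generation *)

Lemma finite_words_of_size_lt n : finite_set [set s : word S | (size s < n)%N].
Proof.
apply: (@sub_finite_set _ _
  (\bigcup_(m in `I_n) range (@tval m 'I_(nmaps S)))) => [s sn|].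
  by exists (size s) => //; exists (in_tuple s).
by apply: bigcup_finite => // m _; apply: finite_image; exact: finite_finset.
Qed.

(** Ratios decay geometrically in the length of a word: once [rho ^+ n < a], a parent of ratio at
    least [a] has length at most [n], hence so many words at most. *)
Lemma finite_Lambda a : 0 < a -> finite_set (Lambda S a).
Proof.
move=> a0; have [rho [m [m0 rho1 mle]]] := ratio_bounds.
(* [2 <= nmaps S] is by definition [1 < nmaps S], so this is index 1; it serves to show
   [0 <= rho]. *)
have i0 : 'I_(nmaps S) := Ordinal (nmaps_ge2 S).
have rho0 : 0 <= rho.
  by have /andP[_] := mle i0; apply: le_trans.
have [n rhona] : exists n, rho ^+ n < a.
  have /cvgr0_norm_lt/(_ _ a0)[n _ /(_ n (leqnn n))] : rho ^+ n @[n --> \oo] --> 0.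
    by apply: cvg_expr; rewrite ger0_norm.
  by rewrite /= ger0_norm ?exprn_ge0 //; exists n.
have wle t : `|wratio t| <= rho ^+ size t.
  elim: t => [|i t IH]; first by rewrite /wratio big_nil normr1.
  rewrite /wratio big_cons normrM exprS ler_pM //.
  by have /andP[] := mle i.
apply: sub_finite_set (finite_words_of_size_lt n.+1) => s.
move=> /Lambda_rcons[t [i [-> _ at_]]] /=.
rewrite size_rcons ltnS leqNgt; apply/negP => nt.
suff /(lt_le_trans rhona) : a <= rho ^+ n by rewrite ltxx.
apply: le_trans (le_trans at_ (wle t)) _.
by apply: ler_wiXn2l => //; exact: ltW.
Qed.

Lemma finite_endpoints a : 0 < a -> finite_set (endpoints S a).
Proof.
by move=> a0; rewrite finite_setU; split;
  apply: finite_image; exact: finite_Lambda.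
Qed.

Lemma finite_neighbour_set a D : 0 < a -> finite_set (neighbour_set S a D).
Proof.
move=> a0; apply: finite_image.
by apply: sub_finite_set (finite_Lambda a0) => s [].
Qed.

(** * The self-similar set and net intervals inside its images *)

Lemma wsim_self_similar K s x : self_similar_set S K -> K x -> K (wsim s x).
Proof.
move=> [_ _ KE] Kx; elim: s => //= i s IH.
by rewrite KE; exists i => //; exists (wsim s x).
Qed.

(** A finite set with two points has a pair at minimal positive distance; any one map of the system
    sends it to a strictly closer pair of distinct points of [K]. *)
Lemma self_similar_infinite K : self_similar_set S K ->
  ~ (exists x, K = [set x]) -> infinite_set K.
Proof.
move=> hK Knt finK; have [[x Kx] _ _] := hK.
have [y [Ky xy]] : exists y, K y /\ x != y.
  apply: contrapT => nex; apply: Knt; exists x; apply/seteqP.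
  split=> [z Kz|_ -> //] /=; apply: contrapT => zx; apply: nex; exists z.
  by split=> //; apply/eqP => xz; apply: zx.
pose dist := [set d : R | exists p : R * R,
  [/\ K p.1, K p.2, p.1 != p.2 & d = `|p.1 - p.2|]].
have [||_ [[u v] [/= Ku Kv uv ->]] dmin] := @finite_set_min _ dist.
- apply: (@sub_finite_set _ _ ((fun p => `|p.1 - p.2|) @` (K `*` K))).
    by move=> _ [p [K1 K2 _ ->]]; exists p.
  by apply: finite_image; exact: finite_setX.
- by exists `|x - y|, (x, y).
pose i := Ordinal (nmaps_ge2 S).
have suv : wsim [:: i] u - wsim [:: i] v = Defs.ratio i * (u - v).
  by rewrite /= /sim; ring.
have : `|u - v| <= `|wsim [:: i] u - wsim [:: i] v|.
  apply: dmin; exists (wsim [:: i] u, wsim [:: i] v); split=> //.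
  - exact: (@wsim_self_similar K [:: i]).
  - exact: (@wsim_self_similar K [:: i]).
  - by rewrite (inj_eq (@wsim_inj [:: i])).
by rewrite suv normrM leNgt gtr_pMl ?ratio_lt1 // normr_gt0 subr_eq0.
Qed.

(** The ratio may be negative, so either image endpoint can be the left one. *)
Lemma wsim_image_itv s :
  wsim s @` `[0, 1]%classic =
  `[Num.min (wsim s 0) (wsim s 1), Num.max (wsim s 0) (wsim s 1)]%classic.
Proof.
rewrite (wsimE s 1) mulr1; set r := wratio s; set d := wsim s 0.
have r0 : r != 0 by exact: wratio_neq0.
apply/seteqP; split => [_ [x + <-]|y].
  rewrite wsimE -/r -/d /= !in_itv /= ge_min le_max => /andP[x0 x1].
  have [r_ge0|r_lt0] := leP 0 r.
  - by apply/andP; split; apply/orP; [left|right]; nra.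
  - by apply/andP; split; apply/orP; [right|left]; nra.
rewrite /= in_itv /= => /andP[yge yle]; exists ((y - d) / r); last first.
  by rewrite wsimE -/r -/d mulrC divfK // subrK.
rewrite /= in_itv /=; have [r_ge0|r_lt0] := leP 0 r.
  have rp : 0 < r by rewrite lt_def r0.
  move: yge yle; rewrite min_l ?max_r ?lerDr // => yge yle.
  by rewrite divr_ge0 ?subr_ge0 //= ler_pdivrMr // mul1r lerBlDr.
have r_le0 := ltW r_lt0.
move: yge yle; rewrite min_r ?max_l ?gerDr // => yge yle.
by rewrite mulr_le0 ?subr_le0 ?invr_le0 //= ler_ndivrMr // mul1r lerBrDr.
Qed.

(** Some [z] in the infinite set S_s(K) avoids the finitely many endpoints. The endpoints [h1], [h2]
    nearest to [z] on either side bound a net interval. It stays inside S_s([0,1]) because the ends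
    [p], [q] of that image are themselves endpoints of generation [a]. *)
Lemma net_interval_subset_wsim K a s : self_similar_set S K ->
  infinite_set K -> K `<=` `[0, 1]%classic -> 0 < a -> Lambda S a s ->
  exists2 D, net_interval S K a D &
    `[D.1, D.2]%classic `<=` wsim s @` `[0, 1]%classic.
Proof.
move=> hK infK K01 a0 sa; have finE := finite_endpoints a0.
have [z [[x Kx zE] zN]] : exists z, (wsim s @` K) z /\ ~ endpoints S a z.
  apply: contrapT => nz; apply: infK.
  have finsK : finite_set (wsim s @` K).
    apply: sub_finite_set finE => z sKz; apply: contrapT => zN.
    by apply: nz; exists z.
  by rewrite -(eq_finite_set (inj_card_eq (in2W (@wsim_inj s)))).
rewrite wsim_image_itv; set p := Num.min _ _; set q := Num.max _ _.
have Ep : endpoints S a p.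
  by rewrite /p /Num.min; case: ifP => _; [left|right]; exists s.
have Eq : endpoints S a q.
  by rewrite /q /Num.max; case: ifP => _; [right|left]; exists s.
have [pz zq] : p <= z /\ z <= q.
  have : (wsim s @` `[0, 1]%classic) z by exists x => //; exact: K01.
  by rewrite wsim_image_itv /= in_itv /= => /andP.
have neqE h : endpoints S a h -> h != z by move=> Eh; apply/eqP => hz; rewrite hz in Eh.
have [||h1 [Eh1 h1z] h1max] := @finite_set_max _ (endpoints S a `&` [set h | h < z]).
- exact: finite_setIl.
- by exists p; split => //=; rewrite lt_neqAle pz neqE.
have [||h2 [Eh2 zh2] h2min] := @finite_set_min _ (endpoints S a `&` [set h | z < h]).
- exact: finite_setIl.
- by exists q; split => //=; rewrite lt_neqAle zq eq_sym neqE.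
exists (h1, h2).
  split=> //=; first exact: lt_trans h1z zh2.
    move=> h Eh /andP[h1h hh2]; have := neqE _ Eh; rewrite neq_lt => /orP[hz|zh].
    - by have := h1max h (conj Eh hz); rewrite leNgt h1h.
    - by have := h2min h (conj Eh zh); rewrite leNgt hh2.
  exists z; split; first by rewrite /= in_itv /= h1z zh2.
  by rewrite -zE; exact: wsim_self_similar.
have ph1 : p <= h1.
  by apply: h1max; split => //=; rewrite lt_neqAle pz neqE.
have h2q : h2 <= q.
  by apply: h2min; split => //=; rewrite lt_neqAle zq eq_sym neqE.
move=> y /=; rewrite !in_itv /= => /andP[h1y yh2].
by rewrite (le_trans ph1 h1y) (le_trans yh2 h2q).
Qed.

Lemma net_interval_nonoverlap K a D1 D2 : net_interval S K a D1 ->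
  net_interval S K a D2 -> D1.1 < D2.1 -> D1.2 <= D2.1.
Proof.
move=> [_ _ _ N _] [E _ _ _ _] lt; rewrite leNgt; apply/negP => gt.
by apply: (N _ E); rewrite lt gt.
Qed.

Lemma net_interval_inj K a D1 D2 : net_interval S K a D1 ->
  net_interval S K a D2 -> D1.1 = D2.1 -> D1 = D2.
Proof.
case: D1 D2 => [u v] [u' w] [/= _ Ev uv Nv _] [/= _ Ew uw Nw _] uu'.
subst u'; congr pair; have [vw|wv|//] := ltgtP v w.
- by case: (Nw _ Ev); rewrite uv vw.
- by case: (Nv _ Ew); rewrite uw wv.
Qed.

End IteratedFunctionSystem.

(** * Counting the points in a ball *)

Theorem corollary3p3 (R : realType) (S : IFS R) (K : set R)
  (hK : self_similar_set S K)
  (hK_nontrivial : ~ (exists x : R, K = [set x]))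
  (hK_hull : convex_hull K = `[0, 1]%classic)
  (hFNC : finite_neighbour_condition S K) :
  weak_separation S.
Proof.
have infK := self_similar_infinite hK hK_nontrivial.
have K01 : K `<=` `[0, 1]%classic by rewrite -hK_hull; exact: sub_smallest.
have [[x0 Kx0] _ _] := hK.
pose G : set (R -> R) := \bigcup_(V in [set V | exists a D,
  [/\ 0 < a, net_interval S K a D & V = neighbour_set S a D]]) V.
have finG : finite_set G.
  by apply: bigcup_finite => // _ [a [D [a0 _ ->]]]; exact: finite_neighbour_set.
have [n /pcard_leP[code]] : exists n, (G #<= `I_n)%card by exact/finite_set_leP.
have [C C0 GC] : exists2 C, 0 < C & forall g, G g -> `|g 1 - g 0| <= C.
  (* Adjoining 0 makes the set nonempty and its maximum nonnegative; adding 1 below makes the bound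
     strictly positive. *)
  have [||C _ GC] := @finite_set_max _
      (0 |` [set `|g 1 - g 0| | g in G]).
  - by rewrite finite_setU; split; [exact: finite_set1|exact: finite_image].
  - by exists 0; left.
  exists (C + 1) => [|g Gg]; first by rewrite ltr_wpDl // GC //; left.
  by apply: ler_wpDr => //; apply: GC; right; exists g.
have [m m0 mle] := Lambda_ratio_ge S.
(* The map T_D^{-1} o S_s has ratio |r_s| / |D| <= C in absolute value, and |r_s| >= m * a, so |D|
   >= (m / C) * a. *)
pose delta := m / C.
have delta0 : 0 < delta by rewrite divr_gt0.
(* Left ends will lie in an interval of length [4 * a]; this counts cells of length [delta * a],
   including a possible last one for the right end. *)
pose M := (Num.trunc (4 / delta)).+1.
(* As [x0] is in [K], the point S_t(x0) is in [0,1] for every word [t]. *)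
exists x0, (M * n)%N => a t c a0.
pose y := wsim t x0.
have /K01 : K y by exact: wsim_self_similar.
rewrite /= in_itv /= => /andP[y0 y1].
set P := _ `&` _.
have /choice[F FP] : forall p, exists Dg : (R * R) * (R -> R), P p ->
    [/\ net_interval S K a Dg.1, G Dg.2, p = netT Dg.1 (Dg.2 y),
        delta * a <= Dg.1.2 - Dg.1.1 & c - 2 * a <= Dg.1.1 <= c + 2 * a].
  move=> p; have [|nPp] := pselect (P p); last by exists (0, id).
  move=> [+ [s sa sp]]; rewrite -{}sp.
  rewrite closed_ballE //= /closed_ball_ /= => cp.
  have [D netD Ds] := net_interval_subset_wsim hK infK K01 a0 sa.
  have D12 : D.1 < D.2 by case: netD.
  have D21 : 0 < D.2 - D.1 by rewrite subr_gt0.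
  have Gg : G (netTinv D \o wsim s).
    by exists (neighbour_set S a D); [exists a, D|exists s].
  exists (D, netTinv D \o wsim s) => _; split=> //=.
  - by rewrite netTinvK.
  - have := GC _ Gg; rewrite /= /netTinv -mulrBl opprB addrA subrK.
    rewrite wsimE mulr1 addrK normrM normfV (gtr0_norm D21) ler_pdivrMr //.
    move=> wC; rewrite /delta mulrAC ler_pdivrMr // [leRHS]mulrC.
    exact: le_trans (mle _ _ a0 sa) wC.
  (* The left end of D is S_s(x) for some x in [0,1], within |r_s| < a of S_s(y), which is itself
     within [a] of [c]. *)
  - have /Ds[x /=] : `[D.1, D.2]%classic D.1 by rewrite /= in_itv /= lexx ltW.
    rewrite in_itv /= => /andP[x_ge0 x_le1] <-.
    have [sa1 _] := sa; move: sa1 cp.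
    rewrite (wsimE s x) (wsimE s y); set r := wratio s; set d := wsim s 0.
    rewrite ltr_norml ler_distl => /andP[ra1 ra2] /andP[c1 c2].
    have xy1 : `|x - y| <= 1 by rewrite ler_norml; lra.
    have : `|r * (x - y)| <= a.
      by rewrite normrM -[a]mulr1 ler_pM // ler_norml; lra.
    rewrite ler_norml => /andP[? ?]; lra.
have da0 : 0 < delta * a by rewrite mulr_gt0.
pose pos p := ((F p).1.1 - (c - 2 * a)) / (delta * a).
have pos_ge0 p : P p -> 0 <= pos p.
  by move=> /FP[_ _ _ _ /andP[cF _]]; rewrite divr_ge0 ?subr_ge0 // ltW.
have pos_lt p : P p -> (Num.trunc (pos p) < M)%N.
  move=> /FP[_ _ _ _ /andP[_ Fc]]; rewrite ltnS; apply: le_truncn.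
  by rewrite ler_pdivrMr // mulrA divfK ?gt_eqF //; lra.
(* If the left ends differ, non-overlap separates them by at least the length of the left interval,
   hence by [delta * a]. Then [pos] differs by at least 1 and the integer parts differ. *)
have pos_inj p q : P p -> P q ->
    Num.trunc (pos p) = Num.trunc (pos q) -> (F p).1.1 = (F q).1.1.
  wlog pq : p q / (F p).1.1 < (F q).1.1 => [hwlog Pp Pq tpq|Pp Pq tpq].
    have [lt|gt|//] := ltgtP (F p).1.1 (F q).1.1; first exact: hwlog.
    by apply/esym; exact: hwlog.
  have [netp _ _ dp _] := FP p Pp; have [netq _ _ _ _] := FP q Pq.
  have pq2 := net_interval_nonoverlap netp netq pq.
  have /andP[lep _] := truncn_itv (pos_ge0 p Pp).
  have /andP[_ ltq] := truncn_itv (pos_ge0 q Pq).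
  have : pos p + 1 <= pos q.
    rewrite -lerBrDl /pos -mulrBl ler_pdivlMr // mul1r; lra.
  by rewrite leNgt (lt_le_trans ltq) // -tpq -natr1 lerD2r.
have code_lt p : P p -> (code (F p).2 < n)%N.
  by move=> /FP[_ Gp _ _ _]; exact: (@funS _ _ _ _ code).
(* The cell and the code of the map are packed as quotient and remainder modulo [n], giving a number
   below [M * n]. *)
pose h p := (Num.trunc (pos p) * n + code (F p).2)%N.
have h_inj : {in P &, injective h}.
  move=> p q /set_mem Pp /set_mem Pq hpq.
  have [netp Gp pE _ _] := FP p Pp; have [netq Gq qE _ _] := FP q Pq.
  have n0 : (0 < n)%N by exact: leq_ltn_trans (code_lt p Pp).
  have tpq : Num.trunc (pos p) = Num.trunc (pos q).
    have := congr1 (divn^~ n) hpq.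
    by rewrite /h /= !divnMDl // !divn_small ?addn0 ?code_lt.
  have cpq : code (F p).2 = code (F q).2.
    have := congr1 (modn^~ n) hpq.
    by rewrite /h /= !modnMDl !modn_small ?code_lt.
  have gpq : (F p).2 = (F q).2 by apply: (@inj _ _ _ code); rewrite ?inE.
  (* The left end fixes D, and the point is T_D(g(y)) with the same [y] throughout. *)
  by rewrite pE qE gpq (net_interval_inj netp netq) //; exact: pos_inj.
rewrite -(card_le_eql (inj_card_eq h_inj)).
apply: subset_card_le => _ [p Pp <-] /=.
apply: (@leq_trans ((Num.trunc (pos p)).+1 * n)%N).
  by rewrite /h mulSnr ltn_add2l code_lt.
by rewrite leq_mul2r pos_lt ?orbT.
Qed.
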